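(* Let $n\ge 1$, let $W$ be a process for the parties $X_1',\dots,X_n'$, and let $Z$ be a process for the parties $X_1'',\dots,X_n''$. Let $P=W\otimes Z$, regarded as an operator for the $n$ combined parties $X_k=X_k'X_k''$, $k=1,\dots,n$. Then $P$ is not a valid process for the parties $X_1,\dots,X_n$ if and only if there exist a nontrivial term $s$ of $W$ and a nontrivial term $t$ of $Z$ such that both of the following hold: 1) for every $k\in\{1,\dots,n\}$, if one of the two terms ($s$ on $X_k'$, or $t$ on $X_k''$) is trivial on its $k$-th party, then the other term is, on its $k$-th party, either trivial or includes the out type; 2) for every $k\in\{1,\dots,n\}$, if one of the two terms ($s$ on $X_k'$, or $t$ on $X_k''$) is in type on its $k$-th party, then the other term includes the out type on its $k$-th party.
   Context: **Parties and operators.** All Hilbert spaces are finite-dimensional and complex. A party $X$ has an input system $x_1$ with Hilbert space $\mathcal H^{x_1}$ and an output system $x_2$ with Hilbert space $\mathcal H^{x_2}$. An operator for parties $X_1,\dots,X_n$ (party $X_k$ having input system $x_{k,1}$ and output system $x_{k,2}$) is an element of $L(\mathcal H)$, the linear operators on $\mathcal H=\bigotimes_{k=1}^n \big(\mathcal H^{x_{k,1}}\otimes\mathcal H^{x_{k,2}}\big)$. **Terms.** For each system $x$ of dimension $d_x$, fix a Hilbert-Schmidt basis $\{\sigma_i^x\}_{i=0}^{d_x^2-1}$ of $L(\mathcal H^x)$: Hermitian operators, pairwise orthogonal with respect to $\langle S,T\rangle=\operatorname{Tr}(S^\dagger T)$, with $\sigma_0^x$ the identity (so $\sigma_i^x$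 is traceless for $i\ge 1$). A Hermitian operator for the parties is expanded uniquely, with real coefficients, in the tensor products of these basis elements. A *term* of the operator is a product basis element (one $\sigma_i$ for each system) that occurs in this expansion with nonzero coefficient. The term in which all factors are identities is called trivial; every other term is nontrivial. **Types on a party.** Let a term have factor $\sigma_i^{x_1}\otimes\sigma_j^{x_2}$ on a party $X$. On $X$ the term is - trivial if $i=j=0$; - *in type* if $i\ge1$ and $j=0$; - *out type* if $i=0$ and $j\ge1$; - said to *include the in type* if $i\ge 1$ ($j$ arbitrary); - said to *include the out type* if $j\ge 1$ ($i$ arbitrary). **Processes.** An operator $W$ for parties $X_1,\dots,X_n$ is a (valid) process if - $W\ge 0$ (positive semidefinite); - $\operatorname{Tr}W=\prod_{k=1}^n \dim\mathcal H^{x_{k,2}}$; - every nontrivial term of $W$ is in type on at least one party. **Combined parties and products.** A party $X'$ with systems $x_1',x_2'$ and a party $X''$ with systems $x_1'',x_2''$ combine into the party $X=X'X''$ with input system $x_1=x_1'x_1''$, $\mathcal H^{x_1}=\mathcal H^{x_1'}\otimes\mathcal H^{x_1''}$, and output system $x_2=x_2'x_2''$, $\mathcal H^{x_2}=\mathcal H^{x_2'}\otimes\mathcal H^{x_2''}$. The product $W\otimes Z$ is the tensor product operator, with tensor factors regrouped so that it is an operator for the combined parties $X_1,\dots,X_n$. As Hilbert-Schmidt basis of the combined system $x'x''$ one uses the products $\sigma_i^{x'}\otimes\sigma_j^{x''}$, whose identity element is the one with $i=j=0$. *)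

(* Defs.v *)
From HB Require Import structures.
From mathcomp Require Import all_boot all_order all_algebra.
From mathcomp Require Import complex mxtens reals.

Set Implicit Arguments.
Unset Strict Implicit.
Unset Printing Implicit Defensive.

Import Order.TTheory GRing.Theory Num.Theory.
Local Open Scope ring_scope.
Local Open Scope sesquilinear_scope.
Local Open Scope complex_scope.

(* A system is the Hilbert space C^dim with a fixed Hilbert-Schmidt basis of
   its operators. The basis is indexed by an arbitrary finite type with a
   distinguished label [lab0] for the identity, rather than by 'I_(dim ^ 2), so
   that a composite system can be labelled by pairs; [sigma_basis] forces
   #|label| = dim ^ 2, and hence 0 < dim. *)
Record system (R : realType) := System {
  dim : nat;
  label : finType;
  lab0 : label;
  sigma : label -> 'M[R[i]]_dim;
  sigma_herm : forall i, sigma i \is hermsymmx;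
  sigma_orth : forall i j, i != j -> \tr ((sigma i)^t* *m sigma j) = 0;
  sigma_id : sigma lab0 = 1%:M;
  sigma_basis : basis_of fullv [seq sigma i | i : label]
}.
Arguments lab0 {R} s.

Record party (R : realType) := Party { inp : system R; out : system R }.

(* Computational basis of the joint space of the parties [X k]: an index gives,
   for each party, a basis vector of its input and of its output space. *)
Definition mindex (R : realType) n (X : 'I_n -> party R) : finType :=
  {dffun forall k : 'I_n, 'I_(dim (inp (X k))) * 'I_(dim (out (X k)))}.

Definition operator (R : realType) n (X : 'I_n -> party R) : Type :=
  'M[R[i]]_#|mindex X|.

Definition entry (R : realType) n (X : 'I_n -> party R)
    (W : operator X) (a b : mindex X) : R[i] :=
  W (enum_rank a) (enum_rank b).

Definition op_of (R : realType) n (X : 'I_n -> party R)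
    (f : mindex X -> mindex X -> R[i]) : operator X :=
  \matrix_(i, j) f (enum_val i) (enum_val j).

Definition labels (R : realType) n (X : 'I_n -> party R) : finType :=
  {dffun forall k : 'I_n, label (inp (X k)) * label (out (X k))}.

(* The tensor product over k of sigma_(s k).1 (x) sigma_(s k).2. *)
Definition product_elt (R : realType) n (X : 'I_n -> party R) (s : labels X) :
    operator X :=
  op_of (fun a b : mindex X =>
    \prod_(k < n) (sigma (s k).1 (a k).1 (b k).1 *
                   sigma (s k).2 (a k).2 (b k).2)).

(* The expansion of a Hermitian operator is unique, so [exists c] and
   "for the c such that" agree; a non-Hermitian operator has no term. *)
Definition is_term (R : realType) n (X : 'I_n -> party R) (W : operator X)
    (s : labels X) : Prop :=
  exists c : labels X -> R,
    W = \sum_(u : labels X) (c u)%:C *: product_elt u /\ c s != 0.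

Section Types.
Variables (R : realType) (n : nat) (X : 'I_n -> party R).
Implicit Types (s : labels X) (k : 'I_n).

Definition includes_in s k : bool := (s k).1 != lab0 (inp (X k)).
Definition includes_out s k : bool := (s k).2 != lab0 (out (X k)).
Definition trivial_on s k : bool := ~~ includes_in s k && ~~ includes_out s k.
Definition in_type s k : bool := includes_in s k && ~~ includes_out s k.

Definition trivial_term s : bool := [forall k, trivial_on s k].

End Types.

Definition psdmx (R : realType) m (A : 'M[R[i]]_m) : Prop :=
  A \is hermsymmx /\ forall v : 'cV[R[i]]_m, 0 <= (v^t* *m A *m v) 0 0.

Definition is_process (R : realType) n (X : 'I_n -> party R) (W : operator X) :
    Prop :=
  [/\ psdmx W,
      \tr W = (\prod_(k < n) dim (out (X k)))%:R
    & forall s : labels X, is_term W s -> ~~ trivial_term s ->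
        exists k : 'I_n, in_type s k].

Section CombineSystem.
Variables (R : realType) (x y : system R).

Definition combine_sigma (ij : label x * label y) : 'M[R[i]]_(dim x * dim y) :=
  sigma ij.1 *t sigma ij.2.

Lemma mxtrace_tens m p (A : 'M[R[i]]_m) (B : 'M[R[i]]_p) :
  \tr (A *t B) = \tr A * \tr B.
Proof.
rewrite /mxtrace mulr_sum; apply: eq_bigr => i _.
by rewrite mxE.
Qed.

Lemma adjmx_tens m p (A : 'M[R[i]]_m) (B : 'M[R[i]]_p) :
  (A *t B)^t* = A^t* *t B^t*.
Proof. by rewrite trmx_tens map_mxT. Qed.

Lemma hermsymmx_adjE m (A : 'M[R[i]]_m) :
  (A \is hermsymmx) = (A == A^t*).
Proof. by rewrite is_hermitianmxE expr0 scale1r. Qed.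

Lemma combine_herm ij : combine_sigma ij \is hermsymmx.
Proof.
rewrite hermsymmx_adjE adjmx_tens.
have := sigma_herm ij.1; rewrite hermsymmx_adjE => /eqP <-.
by have := sigma_herm ij.2; rewrite hermsymmx_adjE => /eqP <-.
Qed.

Lemma combine_tr ij kl :
  \tr ((combine_sigma ij)^t* *m combine_sigma kl) =
  \tr ((sigma ij.1)^t* *m sigma kl.1) * \tr ((sigma ij.2)^t* *m sigma kl.2).
Proof. by rewrite adjmx_tens tensmx_mul mxtrace_tens. Qed.

Lemma combine_orth ij kl : ij != kl ->
  \tr ((combine_sigma ij)^t* *m combine_sigma kl) = 0.
Proof.
case: ij kl => [i j] [k l]; rewrite combine_tr xpair_eqE negb_and /=.
by case/orP => /sigma_orth ->; rewrite ?mul0r ?mulr0.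
Qed.

Lemma combine_id : combine_sigma (lab0 x, lab0 y) = 1%:M.
Proof.
rewrite /combine_sigma /= !sigma_id; apply/matrixP => i j.
rewrite !mxE /= -natrM mulnb -xpair_eqE.
by rewrite -(inj_eq (can_inj (@mxtens_unindexK (dim x) (dim y)))).
Qed.

Lemma hs_norm_eq0 m (A : 'M[R[i]]_m) : \tr (A^t* *m A) = 0 -> A = 0.
Proof.
rewrite /mxtrace => trA0; apply/matrixP => a b; rewrite mxE.
have E i : (A^t* *m A) i i = \sum_j `|A j i| ^+ 2.
  by rewrite mxE; apply: eq_bigr => j _; rewrite !mxE normCKC.
have /eqP := trA0; rewrite psumr_eq0 => [|i _]; last first.
  by rewrite E sumr_ge0 // => j _; rewrite exprn_ge0.
move=> /allP/(_ b (mem_index_enum b)); rewrite E /= psumr_eq0 => [|j _]; last first.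
  by rewrite exprn_ge0.
move=> /allP/(_ a (mem_index_enum a)) /=.
by rewrite sqrf_eq0 normr_eq0 => /eqP.
Qed.

Lemma orth_free m (T : finType) (f : T -> 'M[R[i]]_m) :
  (forall i, f i != 0) ->
  (forall i j, i != j -> \tr ((f i)^t* *m f j) = 0) ->
  free [seq f i | i : T].
Proof.
move=> f0 fo; apply/(@freeP _ _ _ (in_tuple [seq f i | i : T])) => k /= k0 p.
pose t := enum_val (cast_ord (size_image f T) p).
have nthE (q : 'I_(size [seq f i | i : T])) :
    [seq f i | i : T]`_q = f (enum_val (cast_ord (size_image f T) q)).
  by rewrite -(nth_image 0 f (cast_ord (size_image f T) q)).
have : \tr ((f t)^t* *m \sum_(i < size [seq f i | i : T]) k i *: [seq f i | i : T]`_i) = 0.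
  by rewrite k0 mulmx0 mxtrace0.
rewrite mulmx_sumr raddf_sum (bigD1 p) //= big1 => [|q qp]; last first.
  rewrite nthE -scalemxAr mxtraceZ fo ?mulr0 // eq_sym.
  by rewrite (inj_eq enum_val_inj) (inj_eq (@cast_ord_inj _ _ _)).
rewrite addr0 nthE -scalemxAr mxtraceZ => /eqP; rewrite mulf_eq0.
by case/orP => /eqP // /hs_norm_eq0 ft0; have := f0 t; rewrite ft0 eqxx.
Qed.

Lemma sigma_neq0 (z : system R) (i : label z) : sigma i != 0.
Proof. exact: (basis_not0 (sigma_basis z) (image_f (@sigma R z) (isT : i \in label z))). Qed.

Lemma card_label (z : system R) : #|label z| = (dim z * dim z)%N.
Proof.
have := size_basis (X := in_tuple _) (sigma_basis z).
by rewrite dimvf /dim /= size_image.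
Qed.

Lemma combine_basis :
  basis_of fullv [seq combine_sigma ij | ij : label x * label y].
Proof.
rewrite basisEfree subvf size_image card_prod !card_label dimvf.
apply/and3P; split=> //; last by rewrite /dim /= mulnACA.
apply: orth_free => [ij|ij kl]; last exact: combine_orth.
apply: contraTneq isT => ij0.
have := combine_tr ij ij; rewrite ij0 mulmx0 mxtrace0 => /esym/eqP.
by rewrite mulf_eq0 => /orP[] /eqP/hs_norm_eq0/eqP; rewrite (negPf (sigma_neq0 _)).
Qed.

Definition combine_system : system R :=
  System combine_herm combine_orth combine_id combine_basis.

End CombineSystem.

Definition combine_party (R : realType) (X Y : party R) : party R :=
  Party (combine_system (inp X) (inp Y)) (combine_system (out X) (out Y)).

Section Product.
Variables (R : realType) (n : nat) (X' X'' : 'I_n -> party R).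

Definition combine (k : 'I_n) : party R := combine_party (X' k) (X'' k).

(* C^(m * p) = C^m (x) C^p through the indexing [mxtens_unindex] of [*t]. *)
Definition index1 (a : mindex combine) : mindex X' :=
  [ffun k => ((mxtens_unindex (a k).1).1, (mxtens_unindex (a k).2).1)].
Definition index2 (a : mindex combine) : mindex X'' :=
  [ffun k => ((mxtens_unindex (a k).1).2, (mxtens_unindex (a k).2).2)].

Definition product (W : operator X') (Z : operator X'') : operator combine :=
  op_of (fun a b : mindex combine =>
    entry W (index1 a) (index1 b) * entry Z (index2 a) (index2 b)).

End Product.

(* Main.v *)
Require Import Defs.
From HB Require Import structures.
From mathcomp Require Import all_boot all_order all_algebra.
From mathcomp Require Import complex mxtens reals.

(** Positive operators factor as [B^* B] and the product is multiplicative and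
    commutes with adjoints, so [product W Z] is positive; its trace is the
    product of the traces. Hence it can only fail to be a process through its
    terms. By orthogonality and a dimension count the product elements form a
    basis, so the terms of [product W Z] are exactly the pairs of a term of [W]
    and a term of [Z]. Such a pair is in type on no combined party exactly when
    conditions 1 and 2 hold, and if one of its two terms were trivial, a party
    on which the other is in type would make the pair in type there. *)

Set Implicit Arguments.
Unset Strict Implicit.
Unset Printing Implicit Defensive.

Import Order.TTheory GRing.Theory Num.Theory.
Local Open Scope ring_scope.
Local Open Scope sesquilinear_scope.
Local Open Scope complex_scope.

(** * Distributivity and counting over dependent functions *)

(** The sums range over different types [T i], so they are first moved into one tagged type, where
    ordinary distributivity applies; the resulting choices are then read back as dependent
    functions. *)
Lemma prod_sum_dffun (S : comPzSemiRingType) (I : finType) (T : I -> finType)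
    (F : forall i, T i -> S) :
  \prod_i \sum_(x : T i) F i x =
  \sum_(f : {dffun forall i, T i}) \prod_i F i (f i).
Proof.
pose G i := [ffun x : T i => F i x].
have GE i (x : T i) : F i x = G i x by rewrite ffunE.
transitivity (\prod_i \sum_(p in tagged_with T i) untag 0 (G i) p).
  apply: eq_bigr => i _; under eq_bigr do rewrite GE.
  exact: (big_tag (fun i => G i : T i -> S)).
rewrite bigA_distr_big_dep -big_fprod.
rewrite (reindex (@fprod_of_dffun I T)); last exact/onW_bij/fprod_of_dffun_bij.
by apply: eq_bigr => f _; apply: eq_bigr => i _; rewrite GE fprodE.
Qed.

Lemma card_dffun (I : finType) (T : I -> finType) :
  #|{dffun forall i, T i}| = (\prod_i #|T i|)%N.
Proof. by rewrite -card_fprod (bij_eq_card (@dffun_of_fprod_bij I T)). Qed.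

(** * Positive semidefinite matrices as squares *)

Section PositiveSemidefinite.
Variable R : realType.

Lemma psdmx_adj_mul m (B : 'M[R[i]]_m) : psdmx (B^t* *m B).
Proof.
split; first by rewrite hermsymmx_adjE trmx_mul map_mxM trmxCK.
move=> v; rewrite mulmxA -mulmxA -map_mxM -trmx_mul mxE sumr_ge0 // => j _.
by rewrite !mxE mulrC mul_conjC_ge0.
Qed.

(** The spectral theorem gives [A = P^* D P] with [P] unitary and [D] diagonal and nonnegative;
    [sqrt(D) P] is then a factor. *)
Lemma psdmx_factor m (A : 'M[R[i]]_m) :
  psdmx A -> exists B : 'M_m, A = B^t* *m B.
Proof.
case=> Aherm Age0.
have /hermitian_normalmx/orthomx_spectralP := Aherm.
have := spectral_unitarymx A.
move: (spectralmx A) (spectral_diag A) => P d Punit.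
rewrite invmx_unitary // => defA.
(* An eigenvalue is the value of the quadratic form of [A] at its unit eigenvector, the adjoint of a
   row of [P]. *)
have d_ge0 k : 0 <= d 0 k.
  suff -> : d 0 k = (row k P *m A *m (row k P)^t*) 0 0.
    by have := Age0 ((row k P)^t*); rewrite trmxCK.
  have -> : (row k P *m A *m (row k P)^t*) 0 0 = (P *m A *m P^t*) k k.
    by rewrite -row_mul !mxE; apply: eq_bigr => j _; rewrite !mxE.
  rewrite defA !mulmxA (unitarymxP Punit) mul1mx -mulmxA (unitarymxP Punit).
  by rewrite mulmx1 mxE eqxx mulr1n.
exists (diag_mx (map_mx sqrtC d) *m P).
rewrite trmx_mul map_mxM tr_diag_mx map_diag_mx !mulmxA -(mulmxA _ _ (diag_mx _)).
rewrite mulmx_diag defA; congr (_ *m diag_mx _ *m _); apply/rowP => k.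
rewrite !mxE /= conj_Creal ?ger0_real ?sqrtC_ge0 //.
by rewrite -expr2 sqrtCK.
Qed.

End PositiveSemidefinite.

(** * Entries of operators and the basis of product elements *)

Section Operators.
Variables (R : realType) (n : nat) (X : 'I_n -> party R).
Implicit Types (A B : operator X) (a b : mindex X) (s t u : labels X).

Lemma entry_op_of f a b : entry (op_of f : operator X) a b = f a b.
Proof. by rewrite /entry mxE !enum_rankK. Qed.

Lemma operatorP A B : (forall a b, entry A a b = entry B a b) -> A = B.
Proof.
by move=> eqAB; apply/matrixP => i j; have := eqAB (enum_val i) (enum_val j);
  rewrite /entry !enum_valK.
Qed.

Lemma entry_mul A B a b :
  entry (A *m B) a b = \sum_c entry A a c * entry B c b.
Proof.
by rewrite /entry mxE (reindex_onto enum_rank enum_val) => [|i _];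
  rewrite ?enum_valK //; apply: eq_bigl => c; rewrite enum_rankK eqxx.
Qed.

Lemma entry_adj A a b : entry (A^t*) a b = ((entry A b a)^*)%R.
Proof. by rewrite /entry !mxE. Qed.

Lemma trace_entry A : \tr A = \sum_a entry A a a.
Proof.
by rewrite /mxtrace (reindex_onto enum_rank enum_val) => [|i _];
  rewrite ?enum_valK //; apply: eq_bigl => c; rewrite enum_rankK eqxx.
Qed.

Lemma product_elt_herm s : (product_elt s)^t* = product_elt s.
Proof.
apply: operatorP => a b; rewrite entry_adj !entry_op_of rmorph_prod.
apply: eq_bigr => k _; rewrite rmorphM.
have conj_sigma (x : system R) (i : label x) p q :
    ((sigma i p q)^*)%R = sigma i q p.
  by have := sigma_herm i; rewrite hermsymmx_adjE => /eqP {2}->; rewrite !mxE.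
by congr (_ * _); apply: conj_sigma.
Qed.

(** The double sum over basis vectors splits party by party, by distributivity in each of the two
    indices. *)
Lemma trace_product_elt s t :
  \tr ((product_elt s)^t* *m product_elt t) =
  \prod_k (\tr ((sigma (s k).1)^t* *m sigma (t k).1) *
           \tr ((sigma (s k).2)^t* *m sigma (t k).2)).
Proof.
rewrite trace_entry.
(* The factor that party [k] contributes to the summand when [a k = p] and [b k = q]. *)
pose F k (p q : 'I_(Defs.dim (inp (X k))) * 'I_(Defs.dim (out (X k)))) :=
  ((sigma (s k).1 q.1 p.1 * sigma (s k).2 q.2 p.2)^*)%R *
  (sigma (t k).1 q.1 p.1 * sigma (t k).2 q.2 p.2).
transitivity (\sum_(a : mindex X) \sum_(b : mindex X) \prod_k F k (a k) (b k)).
  apply: eq_bigr => a _; rewrite entry_mul; apply: eq_bigr => b _.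
  by rewrite entry_adj !entry_op_of rmorph_prod -big_split.
transitivity (\sum_(a : mindex X) \prod_k \sum_q F k (a k) q).
  by apply: eq_bigr => a _; rewrite (prod_sum_dffun (fun k => F k (a k))).
rewrite -(prod_sum_dffun (fun k p => \sum_q F k p q)).
apply: eq_bigr => k _; rewrite /mxtrace big_distrlr /= [RHS]pair_bigA /=.
apply: eq_bigr => p _; rewrite !mxE big_distrlr /= [RHS]pair_bigA /=.
by apply: eq_bigr => q _; rewrite !mxE /F rmorphM mulrACA.
Qed.

Lemma product_elt_orth s t :
  s != t -> \tr ((product_elt s)^t* *m product_elt t) = 0.
Proof.
move=> neq_st; have [k neq_k] : exists k, s k != t k.
  by apply/existsP; apply: contraNT neq_st => /existsPn eq_st;
    apply/eqP/ffunP => k; apply/eqP; have := eq_st k; rewrite negbK.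
rewrite trace_product_elt (bigD1 k) //=.
move: neq_k; case: (s k) (t k) => [i j] [i' j'].
by rewrite xpair_eqE negb_and /= => /orP[] /sigma_orth ->;
  rewrite ?(mulr0, mul0r).
Qed.

Lemma product_elt_neq0 s : product_elt s != 0.
Proof.
apply: contraTneq isT => s0.
have := trace_product_elt s s; rewrite s0 mulmx0 mxtrace0 => /esym/eqP.
rewrite prodf_seq_eq0 => /hasP[k _ /=].
by rewrite mulf_eq0 => /orP[] /eqP/hs_norm_eq0/eqP;
  rewrite (negPf (sigma_neq0 _)).
Qed.

(** Nonzero orthogonal elements are free, and their number is the full dimension because a system
    has [dim ^ 2] labels. *)
Lemma product_elt_basis :
  basis_of fullv [seq product_elt s | s : labels X].
Proof.
rewrite basisEfree subvf size_image dimvf /dim /=.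
rewrite orth_free; [|exact: product_elt_neq0|exact: product_elt_orth].
rewrite !card_dffun -big_split /= leq_prod // => k _.
by rewrite !card_prod !card_label !card_ord mulnACA.
Qed.

Lemma product_elt_expand A :
  exists c : labels X -> R[i], A = \sum_u c u *: product_elt u.
Proof.
set e := [seq product_elt s | s : labels X].
(* The position of [u] in the list [e], turning coordinates by position into coefficients by
   label. *)
pose r (u : labels X) := cast_ord (esym (size_image _ _)) (enum_rank u) : 'I_(size e).
exists (fun u => coord (in_tuple e) (r u) A).
rewrite {1}(coord_basis (X := in_tuple e) product_elt_basis (memvf A)) /=.
rewrite (reindex r) /=; last first.
  exists (fun i => enum_val (cast_ord (size_image _ _) i)) => i _.
    by rewrite /r cast_ordKV enum_rankK.
  by rewrite /r enum_valK cast_ordK.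
apply: eq_bigr => u _; congr (_ *: _).
by rewrite (nth_image 0 (@product_elt R n X) (enum_rank u)) enum_rankK.
Qed.

(** Pairing with [product_elt s] isolates the coefficient at [s], up to a nonzero squared norm. *)
Lemma product_elt_inj (c d : labels X -> R[i]) :
  \sum_u c u *: product_elt u = \sum_u d u *: product_elt u -> c =1 d.
Proof.
move=> eq_cd s.
have sel (e : labels X -> R[i]) :
    \tr ((product_elt s)^t* *m \sum_u e u *: product_elt u) =
    e s * \tr ((product_elt s)^t* *m product_elt s).
  rewrite mulmx_sumr raddf_sum (bigD1 s) //= big1 => [|u us].
    by rewrite addr0 -scalemxAr mxtraceZ.
  by rewrite -scalemxAr mxtraceZ product_elt_orth ?mulr0 // eq_sym.
have := sel c; rewrite eq_cd sel => /esym/mulIf; apply.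
by apply: contra (product_elt_neq0 s) => /eqP/hs_norm_eq0 ->.
Qed.

(** The product elements are Hermitian, so taking the adjoint conjugates the coefficients;
    uniqueness then makes them real. *)
Lemma herm_expand A : A \is hermsymmx ->
  exists c : labels X -> R, A = \sum_u (c u)%:C *: product_elt u.
Proof.
move=> Aherm; have [c defA] := product_elt_expand A.
suff c_real u : c u = (complex.Re (c u))%:C.
  by exists (fun u => complex.Re (c u)); under eq_bigr do rewrite -c_real.
have : c =1 fun u => ((c u)^*)%R.
  apply: product_elt_inj; rewrite -defA; move: Aherm; rewrite hermsymmx_adjE.
  move=> /eqP ->; rewrite defA; rewrite linear_sum /= raddf_sum.
  by apply: eq_bigr => s _; rewrite linearZ /= map_mxZ product_elt_herm.
by move=> /(_ u)/esym/CrealP/complex_realP [x ->].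
Qed.

(** By uniqueness, any one real expansion decides which labels are terms. *)
Lemma is_termE A (c : labels X -> R) s :
  A = \sum_u (c u)%:C *: product_elt u -> is_term A s <-> c s != 0.
Proof.
move=> defA; split=> [[d [defA' ds0]]|cs0]; last by exists c.
have eq_cd := etrans (esym defA) defA'.
by have /complexI -> := product_elt_inj eq_cd s.
Qed.

End Operators.

(** * Products of operators: multiplication, adjoint, trace and positivity *)

Section Product.
Variables (R : realType) (n : nat) (X' X'' : 'I_n -> party R).
Local Notation X := (combine X' X'').
Implicit Types (A W : operator X') (B Z : operator X'').

Definition pair_index (ab : mindex X' * mindex X'') : mindex X :=
  [ffun k => (mxtens_index ((ab.1 k).1, (ab.2 k).1),
              mxtens_index ((ab.1 k).2, (ab.2 k).2))].

Lemma pair_indexK :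
  cancel pair_index (fun a => (index1 a, index2 a)).
Proof.
case=> a b; congr (_, _); apply/ffunP => k; rewrite !ffunE !mxtens_indexK /=.
  by case: (a k).
by case: (b k).
Qed.

Lemma index_pairK :
  cancel (fun a => (index1 a, index2 a)) pair_index.
Proof.
move=> a; apply/ffunP => k; rewrite !ffunE; case: (a k) => i j.
by congr (_, _); apply: mxtens_unindexK.
Qed.

Lemma sum_index (F : mindex X' -> mindex X'' -> R[i]) :
  \sum_(a : mindex X) F (index1 a) (index2 a) = \sum_a \sum_b F a b.
Proof.
rewrite pair_bigA (reindex pair_index) /=.
  by apply: eq_bigr => -[a b] _; have [/= -> ->] := pair_indexK (a, b).
by apply: onW_bij; exists (fun a => (index1 a, index2 a));
  [apply: pair_indexK | apply: index_pairK].
Qed.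

Lemma entry_product W Z (a b : mindex X) :
  entry (product W Z) a b =
  entry W (index1 a) (index1 b) * entry Z (index2 a) (index2 b).
Proof. exact: entry_op_of. Qed.

Lemma product_mul W A Z B :
  product (W *m A) (Z *m B) = product W Z *m product A B.
Proof.
apply: operatorP => a b; rewrite entry_product 3!entry_mul.
under [RHS]eq_bigr do rewrite !entry_product.
rewrite (sum_index (fun c d =>
  entry W (index1 a) c * entry Z (index2 a) d *
  (entry A c (index1 b) * entry B d (index2 b)))).
rewrite big_distrlr; apply: eq_bigr => c _; apply: eq_bigr => d _.
by rewrite mulrACA.
Qed.

Lemma product_adj W Z : product (W^t*) (Z^t*) = (product W Z)^t*.
Proof.
apply: operatorP => a b.
by rewrite entry_product !entry_adj entry_product rmorphM.
Qed.

Lemma trace_product W Z : \tr (product W Z) = \tr W * \tr Z.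
Proof.
rewrite !trace_entry big_distrlr /=.
under eq_bigr do rewrite entry_product.
exact: (sum_index (fun a b => entry W a a * entry Z b b)).
Qed.

Lemma psdmx_product W Z : psdmx W -> psdmx Z -> psdmx (product W Z).
Proof.
move=> /psdmx_factor[A ->] /psdmx_factor[B ->].
by rewrite (@product_mul (A^t*) A (B^t*) B) product_adj; apply: psdmx_adj_mul.
Qed.

(** * Terms of a product and their types *)

Definition pair_label (st : labels X' * labels X'') : labels X :=
  [ffun k => (((st.1 k).1, (st.2 k).1), ((st.1 k).2, (st.2 k).2))].

Definition unpair_label (u : labels X) : labels X' * labels X'' :=
  ([ffun k => ((u k).1.1, (u k).2.1)], [ffun k => ((u k).1.2, (u k).2.2)]).

Lemma pair_labelK : cancel pair_label unpair_label.
Proof.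
case=> s t; congr (_, _); apply/ffunP => k; rewrite !ffunE /=.
  by case: (s k).
by case: (t k).
Qed.

Lemma unpair_labelK : cancel unpair_label pair_label.
Proof.
by move=> u; apply/ffunP => k; rewrite !ffunE /=; case: (u k) => [[? ?] [? ?]].
Qed.

Lemma product_elt_pair (s : labels X') (t : labels X'') :
  product_elt (pair_label (s, t)) = product (product_elt s) (product_elt t).
Proof.
apply: operatorP => a b; rewrite entry_product !entry_op_of -big_split /=.
by apply: eq_bigr => k _; rewrite !ffunE /= !mxE mulrACA.
Qed.

Lemma product_expand W Z (c : labels X' -> R) (d : labels X'' -> R) :
  W = \sum_s (c s)%:C *: product_elt s ->
  Z = \sum_t (d t)%:C *: product_elt t ->
  product W Z =
  \sum_u (c (unpair_label u).1 * d (unpair_label u).2)%:C *: product_elt u.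
Proof.
move=> -> ->; rewrite (reindex pair_label); last first.
  by apply: onW_bij; exists unpair_label; [apply: pair_labelK | apply: unpair_labelK].
apply: operatorP => a b; rewrite entry_product /entry !summxE big_distrlr.
rewrite pair_bigA; apply: eq_bigr => -[s t] _.
have := entry_product (product_elt s) (product_elt t) a b.
rewrite -product_elt_pair pair_labelK /entry => pairE.
by rewrite [RHS]mxE pairE [X in X * _ = _]mxE [X in _ * X = _]mxE rmorphM mulrACA.
Qed.

(** The coefficient at the pair is the product of the two coefficients; Hermiticity supplies the
    real expansions. *)
Lemma is_term_product W Z (s : labels X') (t : labels X'') :
    W \is hermsymmx -> Z \is hermsymmx ->
  is_term (product W Z) (pair_label (s, t)) <-> is_term W s /\ is_term Z t.
Proof.
move=> /herm_expand[c defW] /herm_expand[d defZ].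
rewrite (is_termE _ (product_expand defW defZ)) pair_labelK /=.
rewrite (is_termE _ defW) (is_termE _ defZ) mulf_eq0 negb_or.
by split=> /andP.
Qed.

Section Labels.
Variables (s : labels X') (t : labels X'').

Lemma includes_in_pair k :
  includes_in (pair_label (s, t)) k = includes_in s k || includes_in t k.
Proof. by rewrite /includes_in ffunE /= xpair_eqE negb_and. Qed.

Lemma includes_out_pair k :
  includes_out (pair_label (s, t)) k = includes_out s k || includes_out t k.
Proof. by rewrite /includes_out ffunE /= xpair_eqE negb_and. Qed.

Lemma trivial_term_pair :
  trivial_term (pair_label (s, t)) = trivial_term s && trivial_term t.
Proof.
apply/forallP/andP => [uT | [/forallP sT /forallP tT] k].
  by split; apply/forallP => k; have := uT k;
    rewrite /trivial_on includes_in_pair includes_out_pair !negb_or;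
    do !case: (_ k).
have := sT k; have := tT k; rewrite /trivial_on includes_in_pair includes_out_pair.
by rewrite !negb_or; do !case: (_ k).
Qed.

Lemma in_type_pair k :
  in_type (pair_label (s, t)) k =
  (includes_in s k || includes_in t k) && ~~ (includes_out s k || includes_out t k).
Proof. by rewrite /in_type includes_in_pair includes_out_pair. Qed.

(** A pair is in type on a party when neither component includes out and at least one includes in.
    Condition 1 excludes trivial against in type, condition 2 also in type against in type; the rest
    is a Boolean check on each party. *)
Lemma no_in_type_pairP :
  (forall k, ~~ in_type (pair_label (s, t)) k) <->
  (forall k,
     (trivial_on s k -> trivial_on t k \/ includes_out t k) /\
     (trivial_on t k -> trivial_on s k \/ includes_out s k)) /\
  (forall k,
     (in_type s k -> includes_out t k) /\ (in_type t k -> includes_out s k)).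
Proof.
split=> [noin | [triv_cond in_cond] k].
  split=> k; have := noin k; rewrite in_type_pair /in_type /trivial_on;
  by case: (includes_in s k) (includes_out s k) (includes_in t k)
           (includes_out t k) => [] [] [] [] //=; auto.
have [] := triv_cond k; have [] := in_cond k.
rewrite in_type_pair /in_type /trivial_on.
case: (includes_in s k) (includes_out s k) (includes_in t k)
      (includes_out t k) => [] [] [] [] //=; intuition.
Qed.

End Labels.

End Product.

(** * When a product of processes fails to be a process *)

Theorem proposition2 (R : realType) (n : nat) (X' X'' : 'I_n -> party R)
    (W : operator X') (Z : operator X'') (n_ge1 : (1 <= n)%N)
    (W_process : is_process W) (Z_process : is_process Z) :
  ~ is_process (product W Z) <->
  exists (s : labels X') (t : labels X''),
    [/\ is_term W s /\ ~~ trivial_term s,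
        is_term Z t /\ ~~ trivial_term t,
        forall k : 'I_n,
          (trivial_on s k -> trivial_on t k \/ includes_out t k) /\
          (trivial_on t k -> trivial_on s k \/ includes_out s k)
      & forall k : 'I_n,
          (in_type s k -> includes_out t k) /\
          (in_type t k -> includes_out s k)].
Proof.
have [W_psd trW W_terms] := W_process; have [Z_psd trZ Z_terms] := Z_process.
have [W_herm _] := W_psd; have [Z_herm _] := Z_psd.
split=> [not_process | [s [t [[sW s_nt] [tZ _] triv_cond in_cond]]]]; last first.
  (* The pair is a nontrivial term of the product, so validity would make it in type on some
     party. *)
  case=> _ _ /(_ (pair_label (s, t))).
  rewrite is_term_product // trivial_term_pair negb_and s_nt.
  case=> // k; apply/negP; move: k.
  exact/no_in_type_pairP.
(* Explicit coefficients make being a term a Boolean condition, so it can be decided whether a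
   nontrivial term in type on no party exists. *)
have [c defW] := herm_expand W_herm; have [d defZ] := herm_expand Z_herm.
have termP (u : labels _) := is_termE u (product_expand defW defZ).
have [/existsP[u /and3P[uP u_nt /forallP u_noin]] | no_bad] :=
  boolP [exists u : labels (combine X' X''),
    [&& c (unpair_label u).1 * d (unpair_label u).2 != 0, ~~ trivial_term u
      & [forall k, ~~ in_type u k]]].
  move: uP u_nt u_noin => /termP; rewrite -[u]unpair_labelK.
  case: (unpair_label u) => s t /is_term_product[] // sW tZ.
  rewrite trivial_term_pair => st_nt noin.
  have [triv_cond in_cond] := iffLR (no_in_type_pairP s t) noin.
  (* Both components must be nontrivial: if [s] were trivial, [t] would be in type on some party,
     and so would the pair. The same argument then serves with the roles exchanged. *)
  exists s, t; split=> //; split=> //; apply/negP => /forallP triv.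
    have /(Z_terms t tZ)[k] : ~~ trivial_term t.
      by apply: contra st_nt => ->; rewrite andbT; apply/forallP.
    case/andP=> t_in t_out; have := noin k; rewrite in_type_pair t_in orbT.
    by have /andP[_ /negPf->] := triv k; rewrite (negPf t_out).
  have /(W_terms s sW)[k] : ~~ trivial_term s.
    by apply: contra st_nt => ->; apply/forallP.
  case/andP=> s_in s_out; have := noin k; rewrite in_type_pair s_in.
  by have /andP[_ /negPf->] := triv k; rewrite (negPf s_out).
(* With no such term the product is a process after all; the trace condition holds because output
   dimensions multiply. *)
case: not_process; split; first exact: psdmx_product.
  rewrite trace_product trW trZ -natrM -big_split.
  by congr _%:R; apply: eq_bigr.
move=> u /termP uP u_nt; apply/existsP.
apply: contraNT no_bad => /existsPn u_noin; apply/existsP; exists u.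
by rewrite uP u_nt; apply/forallP.
Qed.
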